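(* Let $K$ be a field, $\lambda\in K$, and let $(A,\mu,\Delta,\alpha,\beta,\psi,\omega)$ be a $\lambda$-infBH-bialgebra over $K$ such that $\alpha,\beta,\psi,\omega$ are invertible. Then $(A,\star,\alpha,\beta)$ is a (left) BiHom-pre-Lie algebra, where $\star:A\otimes A\to A$ is given by $$a\star b=\big(\alpha^{-2}\beta\omega^{-1}(b_1)\,\beta^{-1}(a)\big)\,\psi^{-1}(b_2),\qquad a,b\in A.$$
   Context: Write $ab=\mu(a\otimes b)$ and $\Delta(a)=a_1\otimes a_2$ (Sweedler notation). A $\lambda$-infBH-bialgebra $(A,\mu,\Delta,\alpha,\beta,\psi,\omega)$ consists of a vector space $A$ and linear maps $\mu:A\otimes A\to A$, $\Delta:A\to A\otimes A$, $\alpha,\beta,\psi,\omega:A\to A$ such that: (i) (BiHom-associative algebra) $\alpha\beta=\beta\alpha$, $\alpha(ab)=\alpha(a)\alpha(b)$, $\beta(ab)=\beta(a)\beta(b)$, $\alpha(a)(bc)=(ab)\beta(c)$; (ii) (BiHom-coassociative coalgebra) $\psi\omega=\omega\psi$, $(\psi\otimes\psi)\Delta=\Delta\psi$, $(\omega\otimes\omega)\Delta=\Delta\omega$, $(\Delta\otimes\psi)\Delta=(\omega\otimes\Delta)\Delta$; (iii) $\alpha,\beta$ commute with $\psi,\omega$; $(\alpha\otimes\alpha)\Delta=\Delta\alpha$, $(\beta\otimes\beta)\Delta=\Delta\beta$; $\psi(ab)=\psi(a)\psi(b)$, $\omega(ab)=\omega(a)\omega(b)$; (iv) $\Delta(ab)=\omega(a)b_1\otimes\beta(b_2)+\alpha(a_1)\otimes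 a_2\psi(b)+\lambda\,\alpha\omega(a)\otimes\beta\psi(b)$. A (left) BiHom-pre-Lie algebra $(A,\cdot,\alpha,\beta)$ consists of a vector space $A$ and linear maps $\cdot:A\otimes A\to A$, $\alpha,\beta:A\to A$ with $\alpha\beta=\beta\alpha$, $\alpha(a\cdot b)=\alpha(a)\cdot\alpha(b)$, $\beta(a\cdot b)=\beta(a)\cdot\beta(b)$ and $$\alpha\beta(a)\cdot(\alpha(b)\cdot c)-(\beta(a)\cdot\alpha(b))\cdot\beta(c)=\alpha\beta(b)\cdot(\alpha(a)\cdot c)-(\beta(b)\cdot\alpha(a))\cdot\beta(c)$$ for all $a,b,c\in A$. *)

(* Defs.v *)
From HB Require Import structures.
From mathcomp Require Import all_boot all_algebra.
From mathcomp Require Import boolp.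

Set Implicit Arguments.
Unset Strict Implicit.
Unset Printing Implicit Defensive.

Import GRing.Theory.
Local Open Scope ring_scope.

(* Tensor product of two (possibly infinite-dimensional) K-vector spaces.
   The sequence [:: (u1, v1); ..; (un, vn)] stands for the formal sum of the
   ui (x) vi; scalars are absorbed in the first factor.  The universal
   property is given by tlift_tens, tensor_ind and linear_tensor_eq. *)
Section TensorRel.
Variables (K : fieldType) (U V : lmodType K).

Inductive tensor_eq : seq (U * V) -> seq (U * V) -> Prop :=
| tensor_eq_refl s : tensor_eq s s
| tensor_eq_sym s t : tensor_eq s t -> tensor_eq t s
| tensor_eq_trans s t r : tensor_eq s t -> tensor_eq t r -> tensor_eq s r
| tensor_eq_cat s s' t t' :
    tensor_eq s s' -> tensor_eq t t' -> tensor_eq (s ++ t) (s' ++ t')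
| tensor_eq_catC s t : tensor_eq (s ++ t) (t ++ s)
| tensor_eq_addl u u' v :
    tensor_eq [:: (u + u', v)] [:: (u, v); (u', v)]
| tensor_eq_addr u v v' :
    tensor_eq [:: (u, v + v')] [:: (u, v); (u, v')]
| tensor_eq_scale a u v : tensor_eq [:: (a *: u, v)] [:: (u, a *: v)]
| tensor_eq_zero v : tensor_eq [:: (0, v)] [::].

Definition tensor_eqb (s t : seq (U * V)) : bool := `[< tensor_eq s t >].

Lemma tensor_eqb_refl : reflexive tensor_eqb.
Proof. by move=> s; apply/asboolP; apply: tensor_eq_refl. Qed.

Lemma tensor_eqb_sym : symmetric tensor_eqb.
Proof.
by move=> s t; apply/asboolP/asboolP; apply: tensor_eq_sym.
Qed.

Lemma tensor_eqb_trans : transitive tensor_eqb.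
Proof.
move=> t s r /asboolP st /asboolP tr; apply/asboolP.
exact: tensor_eq_trans st tr.
Qed.

Canonical tensor_equiv :=
  EquivRel tensor_eqb tensor_eqb_refl tensor_eqb_sym tensor_eqb_trans.

Definition tensor : Type := {eq_quot tensor_equiv}%qT.
HB.instance Definition _ := Choice.on tensor.

Definition tensor_class (s : seq (U * V)) : tensor :=
  (\pi_({eq_quot tensor_equiv}) s)%qT.
Definition tensor_repr (x : tensor) : seq (U * V) :=
  repr (x : {eq_quot tensor_equiv}%qT).

Lemma tensor_reprK : cancel tensor_repr tensor_class.
Proof. by move=> x; apply: reprK. Qed.

Lemma tensor_classP s t : tensor_class s = tensor_class t <-> tensor_eq s t.
Proof.
split=> [/eqmodP/asboolP //|st].
by apply/eqmodP; apply/asboolP.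
Qed.

Lemma tensor_repr_class s : tensor_eq (tensor_repr (tensor_class s)) s.
Proof. by apply/tensor_classP; rewrite tensor_reprK. Qed.

Let scale_seq (a : K) (s : seq (U * V)) := [seq (a *: p.1, p.2) | p <- s].

Definition tensor_zero : tensor := tensor_class [::].
Definition tensor_add (x y : tensor) : tensor :=
  tensor_class (tensor_repr x ++ tensor_repr y).
Definition tensor_scale (a : K) (x : tensor) : tensor :=
  tensor_class (scale_seq a (tensor_repr x)).
Definition tensor_opp (x : tensor) : tensor := tensor_scale (-1) x.

Lemma tensor_addE s t :
  tensor_add (tensor_class s) (tensor_class t) = tensor_class (s ++ t).
Proof.
by apply/tensor_classP; apply: tensor_eq_cat; apply: tensor_repr_class.
Qed.

Lemma tensor_eq_scale_seq a s t :
  tensor_eq s t -> tensor_eq (scale_seq a s) (scale_seq a t).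
Proof.
elim=> {s t} [s|s t _|s t r _ IH1 _|s s' t t' _ IH1 _ IH2|s t|u u' v|u v v'|
  b u v|v] /=.
- exact: tensor_eq_refl.
- exact: tensor_eq_sym.
- exact: tensor_eq_trans.
- by rewrite /scale_seq !map_cat; apply: tensor_eq_cat.
- by rewrite /scale_seq !map_cat; apply: tensor_eq_catC.
- by rewrite scalerDr; apply: tensor_eq_addl.
- exact: tensor_eq_addr.
- by rewrite scalerA mulrC -scalerA; apply: tensor_eq_scale.
- by rewrite scaler0; apply: tensor_eq_zero.
Qed.

Lemma tensor_scaleE a s :
  tensor_scale a (tensor_class s) = tensor_class (scale_seq a s).
Proof.
apply/tensor_classP; apply: tensor_eq_scale_seq; exact: tensor_repr_class.
Qed.

Let tensorP (P : tensor -> Prop) :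
  (forall s, P (tensor_class s)) -> forall x, P x.
Proof. by move=> H x; rewrite -(tensor_reprK x). Qed.

Lemma tensor_addA : associative tensor_add.
Proof.
elim/tensorP=> s; elim/tensorP=> t; elim/tensorP=> r.
by rewrite !tensor_addE catA.
Qed.

Lemma tensor_addC : commutative tensor_add.
Proof.
elim/tensorP=> s; elim/tensorP=> t.
by rewrite !tensor_addE; apply/tensor_classP; apply: tensor_eq_catC.
Qed.

Lemma tensor_add0 : left_id tensor_zero tensor_add.
Proof. by elim/tensorP=> s; rewrite tensor_addE. Qed.

Lemma tensor_scaleDl x : {morph tensor_scale^~ x : a b / a + b >-> tensor_add a b}.
Proof.
elim/tensorP: x => s a b; rewrite !tensor_scaleE tensor_addE.
apply/tensor_classP; elim: s => [|[u v] s IH] /=; first exact: tensor_eq_refl.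
apply: (@tensor_eq_trans _ ([:: (a *: u, v); (b *: u, v)]
                            ++ (scale_seq a s ++ scale_seq b s))).
  apply: (@tensor_eq_cat [:: _]); last exact: IH.
  by rewrite scalerDl; apply: tensor_eq_addl.
apply: (@tensor_eq_cat [:: _] [:: _]); first exact: tensor_eq_refl.
rewrite -[X in tensor_eq _ (_ ++ X)](cat1s (b *: u, v)) catA.
rewrite -[X in tensor_eq X](cat1s (b *: u, v)) catA.
by apply: tensor_eq_cat; [apply: tensor_eq_catC|apply: tensor_eq_refl].
Qed.

Lemma tensor_scale0 x : tensor_scale 0 x = tensor_zero.
Proof.
elim/tensorP: x => s; rewrite tensor_scaleE; apply/tensor_classP.
elim: s => [|[u v] s IH] /=; first exact: tensor_eq_refl.
rewrite scale0r; apply: (@tensor_eq_cat [:: _] [::]) => //.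
exact: tensor_eq_zero.
Qed.

Lemma tensor_scale1 : left_id 1 tensor_scale.
Proof.
elim/tensorP=> s; rewrite tensor_scaleE; congr tensor_class.
by elim: s => [|[u v] s IH] //=; rewrite scale1r IH.
Qed.

Lemma tensor_addN : left_inverse tensor_zero tensor_opp tensor_add.
Proof.
move=> x; rewrite -{2}(tensor_scale1 x) -tensor_scaleDl addNr.
exact: tensor_scale0.
Qed.

HB.instance Definition _ :=
  GRing.isZmodule.Build tensor tensor_addA tensor_addC tensor_add0 tensor_addN.

Lemma tensor_scaleA a b (x : tensor) :
  tensor_scale a (tensor_scale b x) = tensor_scale (a * b) x.
Proof.
elim/tensorP: x => s; rewrite !tensor_scaleE; congr tensor_class.
by elim: s => [|[u v] s IH] //=; rewrite scalerA IH.
Qed.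

Lemma tensor_scaleDr : right_distributive tensor_scale +%R.
Proof.
move=> a; elim/tensorP=> s; elim/tensorP=> t.
by rewrite -[_ + _]/(tensor_add _ _) -[RHS]/(tensor_add _ _)
     !(tensor_addE, tensor_scaleE) /scale_seq map_cat.
Qed.

HB.instance Definition _ :=
  GRing.Zmodule_isLmodule.Build K tensor
    tensor_scaleA tensor_scale1 tensor_scaleDr tensor_scaleDl.

Definition tens (u : U) (v : V) : tensor := tensor_class [:: (u, v)].

Lemma tens_bilinear : bilinear_for *:%R *:%R tens.
Proof.
split=> [v a u u'|u a v v'].
- rewrite -[RHS]/(tensor_add (tensor_scale a (tens u v)) (tens u' v)).
  rewrite tensor_scaleE tensor_addE; apply/tensor_classP.
  exact: tensor_eq_addl.
- rewrite -[RHS]/(tensor_add (tensor_scale a (tens u v)) (tens u v')).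
  rewrite tensor_scaleE tensor_addE; apply/tensor_classP.
  apply: tensor_eq_trans (tensor_eq_addr _ _ _) _.
  apply: (@tensor_eq_cat [:: _] [:: _] [:: _] [:: _]).
    by apply: tensor_eq_sym; apply: tensor_eq_scale.
  exact: tensor_eq_refl.
Qed.
HB.instance Definition _ :=
  bilinear_isBilinear.Build K U V tensor *:%R *:%R tens tens_bilinear.

Lemma tensor_ind (P : tensor -> Prop) :
  P 0 -> (forall x y, P x -> P y -> P (x + y)) -> (forall u v, P (tens u v)) ->
  forall x, P x.
Proof.
move=> P0 PD Pt; apply: tensorP; elim=> [|[u v] s IH]; first exact: P0.
by rewrite -cat1s -tensor_addE; exact: PD (Pt u v) IH.
Qed.

End TensorRel.

Notation "u ⊗ v" := (tens u v) (at level 40, left associativity) : ring_scope.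

Section Lift.
Variables (K : fieldType) (U V W : lmodType K) (f : {bilinear U -> V -> W}).

Definition tlift (x : tensor U V) : W := \sum_(p <- tensor_repr x) f p.1 p.2.

Let flift (s : seq (U * V)) : W := \sum_(p <- s) f p.1 p.2.

Lemma flift_eq s t : tensor_eq s t -> flift s = flift t.
Proof.
elim=> {s t} [//|s t _ -> //|s t r _ -> _ -> //|s s' t t' _ IH1 _ IH2|s t|
  u u' v|u v v'|a u v|v]; rewrite /flift ?big_cat ?big_cons ?big_nil /= ?addr0.
- by congr (_ + _).
- exact: addrC.
- by rewrite linearDl.
- by rewrite linearDr.
- by rewrite linearZl_LR linearZr_LR.
- by rewrite linear0l.
Qed.

Lemma tlift_class s : tlift (tensor_class s) = flift s.
Proof. exact/flift_eq/tensor_repr_class. Qed.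

Lemma tlift_is_linear : linear tlift.
Proof.
move=> a x y; rewrite -(tensor_reprK x) -(tensor_reprK y).
rewrite -[_ + _ in LHS]/(tensor_add (tensor_scale _ _) _).
rewrite tensor_scaleE tensor_addE !tlift_class /flift big_cat big_map scaler_sumr.
by congr (_ + _); apply: eq_bigr => p _; rewrite linearZl_LR.
Qed.
HB.instance Definition _ :=
  GRing.isLinear.Build K (tensor U V) W *:%R tlift tlift_is_linear.

Lemma tlift_tens u v : tlift (u ⊗ v) = f u v.
Proof. by rewrite tlift_class /flift big_seq1. Qed.

End Lift.

Lemma linear_tensor_eq (K : fieldType) (U V W : lmodType K)
    (g h : {linear tensor U V -> W}) :
  (forall u v, g (u ⊗ v) = h (u ⊗ v)) -> g =1 h.
Proof.
move=> gh; elim/tensor_ind=> [|x y IHx IHy|//]; first by rewrite !linear0.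
by rewrite !linearD IHx IHy.
Qed.

Section Map.
Variables (K : fieldType) (U V U' V' : lmodType K).
Variables (f : {linear U -> U'}) (g : {linear V -> V'}).

Definition tmap_tens (u : U) (v : V) : tensor U' V' := f u ⊗ g v.

Lemma tmap_tens_bilinear : bilinear_for *:%R *:%R tmap_tens.
Proof.
split=> [v a u u'|u a v v'] /=; rewrite /tmap_tens linearP.
  by rewrite linearPl.
by rewrite linearPr.
Qed.
HB.instance Definition _ :=
  bilinear_isBilinear.Build K U V (tensor U' V') *:%R *:%R
    tmap_tens tmap_tens_bilinear.

Definition tmap : {linear tensor U V -> tensor U' V'} := tlift tmap_tens.

Lemma tmapE u v : tmap (u ⊗ v) = f u ⊗ g v.
Proof. exact: tlift_tens. Qed.

End Map.

Section Assoc.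
Variables (K : fieldType) (U V W : lmodType K).

Definition tassoc_right (w : W) (u : U) (v : V) : tensor U (tensor V W) := u ⊗ (v ⊗ w).

Lemma tassoc_right_bilinear w : bilinear_for *:%R *:%R (tassoc_right w).
Proof.
split=> [v a u u'|u a v v'] /=; rewrite /tassoc_right.
  by rewrite linearPl.
by rewrite linearPl linearPr.
Qed.
HB.instance Definition _ w :=
  bilinear_isBilinear.Build K U V (tensor U (tensor V W)) *:%R *:%R
    (tassoc_right w) (tassoc_right_bilinear w).

Definition tassoc_left (x : tensor U V) (w : W) : tensor U (tensor V W) :=
  tlift (tassoc_right w) x.

Lemma tassoc_left_bilinear : bilinear_for *:%R *:%R tassoc_left.
Proof.
split=> [w a x y|x a w w'] /=; first exact: linearP.
elim/tensor_ind: x => [|x y IHx IHy|u v]; rewrite /tassoc_left.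
- by rewrite !linear0 ?addr0.
- rewrite !linearD addrACA; congr (_ + _); [exact: IHx|exact: IHy].
- by rewrite !tlift_tens /= /tassoc_right !linearPr.
Qed.
HB.instance Definition _ :=
  bilinear_isBilinear.Build K (tensor U V) W (tensor U (tensor V W)) *:%R *:%R
    tassoc_left tassoc_left_bilinear.

Definition tassoc : {linear tensor (tensor U V) W -> tensor U (tensor V W)} := tlift tassoc_left.

Lemma tassocE u v w : tassoc ((u ⊗ v) ⊗ w) = u ⊗ (v ⊗ w).
Proof. by rewrite [LHS]tlift_tens [LHS]tlift_tens. Qed.

End Assoc.

Section Inverse.
Variables (K : fieldType) (U V : lmodType K).

Lemma bij_inverse (f : U -> V) :
  bijective f -> {g : V -> U | cancel f g /\ cancel g f}.
Proof. by move=> bij_f; apply: cid; case: bij_f => g; exists g. Qed.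

Definition linv_fun (f : {linear U -> V}) (bij_f : bijective f) : V -> U :=
  sval (bij_inverse bij_f).

Variables (f : {linear U -> V}) (bij_f : bijective f).

Lemma linv_funK : cancel f (linv_fun bij_f).
Proof. by rewrite /linv_fun; case: bij_inverse => g []. Qed.

Lemma linv_funKV : cancel (linv_fun bij_f) f.
Proof. by rewrite /linv_fun; case: bij_inverse => g []. Qed.

Lemma linv_is_linear : linear (linv_fun bij_f).
Proof.
move=> a x y; apply: (can_inj linv_funK).
by rewrite linearP !linv_funKV.
Qed.
HB.instance Definition _ :=
  GRing.isLinear.Build K V U *:%R (linv_fun bij_f) linv_is_linear.

Definition linv : {linear V -> U} := linv_fun bij_f.

Lemma linvK : cancel f linv. Proof. exact: linv_funK. Qed.
Lemma linvKV : cancel linv f. Proof. exact: linv_funKV. Qed.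

End Inverse.

Section Mul.
Variables (K : fieldType) (A : lmodType K) (mu : {linear tensor A A -> A}) (a : A).

Definition lmul_fun (x : A) : A := mu (a ⊗ x).
Definition rmul_fun (x : A) : A := mu (x ⊗ a).

Lemma lmul_is_linear : linear lmul_fun.
Proof. by move=> c x y; rewrite /lmul_fun linearPr linearP. Qed.
HB.instance Definition _ := GRing.isLinear.Build K A A *:%R lmul_fun lmul_is_linear.

Lemma rmul_is_linear : linear rmul_fun.
Proof. by move=> c x y; rewrite /rmul_fun linearPl linearP. Qed.
HB.instance Definition _ := GRing.isLinear.Build K A A *:%R rmul_fun rmul_is_linear.

Definition lmul : {linear A -> A} := lmul_fun.
Definition rmul : {linear A -> A} := rmul_fun.

End Mul.

Section BiHom.
Variables (K : fieldType) (A : lmodType K).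
Implicit Types (mu : {linear tensor A A -> A}) (Delta : {linear A -> tensor A A}).
Implicit Types (alpha beta psi omega : {linear A -> A}).

Record bihom_associative mu alpha beta : Prop := BiHomAssociative {
  bha_comm : forall a, alpha (beta a) = beta (alpha a);
  bha_alphaM : forall a b, alpha (mu (a ⊗ b)) = mu (alpha a ⊗ alpha b);
  bha_betaM : forall a b, beta (mu (a ⊗ b)) = mu (beta a ⊗ beta b);
  bha_assoc : forall a b c,
    mu (alpha a ⊗ mu (b ⊗ c)) = mu (mu (a ⊗ b) ⊗ beta c)
}.

Record bihom_coassociative Delta psi omega : Prop := BiHomCoassociative {
  bhc_comm : forall a, psi (omega a) = omega (psi a);
  bhc_psiD : forall a, tmap psi psi (Delta a) = Delta (psi a);
  bhc_omegaD : forall a, tmap omega omega (Delta a) = Delta (omega a);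
  bhc_coassoc : forall a,
    tassoc A A A (tmap Delta psi (Delta a)) = tmap omega Delta (Delta a)
}.

Record infBH_bialgebra (lambda : K) mu Delta alpha beta psi omega : Prop :=
  InfBHBialgebra {
  ibh_assoc : bihom_associative mu alpha beta;
  ibh_coassoc : bihom_coassociative Delta psi omega;
  ibh_alpha_psi : forall a, alpha (psi a) = psi (alpha a);
  ibh_alpha_omega : forall a, alpha (omega a) = omega (alpha a);
  ibh_beta_psi : forall a, beta (psi a) = psi (beta a);
  ibh_beta_omega : forall a, beta (omega a) = omega (beta a);
  ibh_alphaD : forall a, tmap alpha alpha (Delta a) = Delta (alpha a);
  ibh_betaD : forall a, tmap beta beta (Delta a) = Delta (beta a);
  ibh_psiM : forall a b, psi (mu (a ⊗ b)) = mu (psi a ⊗ psi b);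
  ibh_omegaM : forall a b, omega (mu (a ⊗ b)) = mu (omega a ⊗ omega b);
  (* Δ(ab) = ω(a)b₁ ⊗ β(b₂) + α(a₁) ⊗ a₂ψ(b) + λ αω(a) ⊗ βψ(b) *)
  ibh_deriv : forall a b,
    Delta (mu (a ⊗ b)) =
      tmap (lmul mu (omega a)) beta (Delta b)
      + tmap alpha (rmul mu (psi b)) (Delta a)
      + lambda *: (alpha (omega a) ⊗ beta (psi b))
}.

Record bihom_preLie (dot : {linear tensor A A -> A}) alpha beta : Prop := BiHomPreLie {
  bhp_comm : forall a, alpha (beta a) = beta (alpha a);
  bhp_alphaM : forall a b, alpha (dot (a ⊗ b)) = dot (alpha a ⊗ alpha b);
  bhp_betaM : forall a b, beta (dot (a ⊗ b)) = dot (beta a ⊗ beta b);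
  bhp_preLie : forall a b c,
    dot (alpha (beta a) ⊗ dot (alpha b ⊗ c))
      - dot (dot (beta a ⊗ alpha b) ⊗ beta c)
    = dot (alpha (beta b) ⊗ dot (alpha a ⊗ c))
      - dot (dot (beta b ⊗ alpha a) ⊗ beta c)
}.

End BiHom.

Section Star.
Variables (K : fieldType) (A : lmodType K).
Variables (mu : {linear tensor A A -> A}) (Delta : {linear A -> tensor A A}).
Variables (alpha beta psi omega : {linear A -> A}).
Hypotheses (alpha_bij : bijective alpha) (beta_bij : bijective beta).
Hypotheses (psi_bij : bijective psi) (omega_bij : bijective omega).

(* (α⁻²βω⁻¹(b₁) β⁻¹(a)) ψ⁻¹(b₂) *)
Definition star_tens (a b : A) : A :=
  mu (tmap (rmul mu (linv beta_bij a)
              \o (linv alpha_bij \o linv alpha_bij \o beta \o linv omega_bij))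
           (linv psi_bij) (Delta b)).

Lemma star_tens_bilinear : bilinear_for *:%R *:%R star_tens.
Proof.
split=> [b c a a'|a c b b'] /=; rewrite /star_tens; last by rewrite !linearP.
elim/tensor_ind: (Delta b) => [|x y IHx IHy|u v].
- by rewrite !linear0 ?addr0.
- by rewrite !(linearD (tmap _ _)) !(linearD mu) IHx IHy scalerDr addrACA.
- by rewrite !tmapE /= /rmul_fun linearP linearPr linearP linearPl linearP.
Qed.
HB.instance Definition _ :=
  bilinear_isBilinear.Build K A A A *:%R *:%R star_tens star_tens_bilinear.

Definition star : {linear tensor A A -> A} := tlift star_tens.

Lemma starE a b : star (a ⊗ b) = star_tens a b.
Proof. exact: tlift_tens. Qed.

End Star.

(* Main.v *)
(* Classically [a * b = b1 a b2], and expanding [Delta] of [c1 b c2] with the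
   weighted derivation rule gives
     a * (b * c) - (a * b) * c
       = c1 b c2 a c3 + c1 a c2 b c3 + lambda (c1 b a c2 + c1 a b c2),
   which is symmetric in [a] and [b].  The twisted identity has the same shape;
   the twists are matched by pushing the structure maps and their inverses onto
   the leaves and bracketing every product to the right, which is a normal form
   because [alpha], [beta], [psi], [omega] commute and are multiplicative. *)
Require Import Defs.
From mathcomp Require Import all_boot all_algebra.
Import GRing.Theory.
Local Open Scope ring_scope.

(** * Inverses of multiplicative and comultiplicative maps *)

Lemma can_morph1 {T : Type} {f g h : T -> T} :
  cancel g h -> cancel h g ->
  (forall x, f (g x) = g (f x)) -> forall x, f (h x) = h (f x).
Proof. by move=> gK hK fg x; apply: (can_inj gK); rewrite -fg !hK. Qed.

Section InverseStructure.
Context {K : fieldType} {A : lmodType K}.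
Context {f g : {linear A -> A}} (fK : cancel f g) (gK : cancel g f).

Lemma can_mulM {mu : {linear tensor A A -> A}} :
  (forall a b, f (mu (a ⊗ b)) = mu (f a ⊗ f b)) ->
  forall a b, g (mu (a ⊗ b)) = mu (g a ⊗ g b).
Proof. by move=> fM a b; apply: (can_inj fK); rewrite fM !gK. Qed.

Lemma can_comulM {Delta : {linear A -> tensor A A}} :
  (forall a, tmap f f (Delta a) = Delta (f a)) ->
  forall a, tmap g g (Delta a) = Delta (g a).
Proof.
move=> fD a; rewrite -{1}(gK a) -fD.
elim/tensor_ind: (Delta (g a)) => [|x y IHx IHy|u v].
- by rewrite !linear0.
- by rewrite !linearD IHx IHy.
- by rewrite !tmapE !fK.
Qed.

End InverseStructure.

(** * Twisted products, with the inverses given only through cancellation *)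

Section Star.
Context {K : fieldType} {lambda : K} {A : lmodType K}.
Context {mu : {linear tensor A A -> A}} {Delta : {linear A -> tensor A A}}.
Context {alpha beta psi omega : {linear A -> A}}.
Context {alphaV betaV psiV omegaV : {linear A -> A}}.
Hypothesis hA : infBH_bialgebra lambda mu Delta alpha beta psi omega.
Hypotheses (alphaK : cancel alpha alphaV) (alphaVK : cancel alphaV alpha).
Hypotheses (betaK : cancel beta betaV) (betaVK : cancel betaV beta).
Hypotheses (psiK : cancel psi psiV) (psiVK : cancel psiV psi).
Hypotheses (omegaK : cancel omega omegaV) (omegaVK : cancel omegaV omega).

Let hm := ibh_assoc hA.
Let hd := ibh_coassoc hA.

Let ba x : beta (alpha x) = alpha (beta x).
Proof. by rewrite (bha_comm hm). Qed.
Let pa x : psi (alpha x) = alpha (psi x).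
Proof. by rewrite (ibh_alpha_psi hA). Qed.
Let oa x : omega (alpha x) = alpha (omega x).
Proof. by rewrite (ibh_alpha_omega hA). Qed.
Let pb x : psi (beta x) = beta (psi x).
Proof. by rewrite (ibh_beta_psi hA). Qed.
Let ob x : omega (beta x) = beta (omega x).
Proof. by rewrite (ibh_beta_omega hA). Qed.
Let op x : omega (psi x) = psi (omega x).
Proof. by rewrite (bhc_comm hd). Qed.

Let commV {f fV g gV : A -> A} (fK : cancel f fV) (fVK : cancel fV f)
    (gK : cancel g gV) (gVK : cancel gV g) (fg : forall x, f (g x) = g (f x)) :
  (forall x, f (gV x) = gV (f x)) * (forall x, fV (g x) = g (fV x))
  * (forall x, fV (gV x) = gV (fV x)).
Proof.
have fgV := can_morph1 gK gVK fg.
have fVg := can_morph1 fK fVK (fun x => esym (fg x)).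
split=> [|x]; first by split=> // x.
by rewrite -(can_morph1 fK fVK (fun x => esym (fgV x))).
Qed.

(** Every rule sorts the maps, from the outside in, as [alpha], [beta], [psi], [omega], each ranked
    together with its inverse. Inverse pairs thus become adjacent and [cancelE] removes them. *)
Let commE := (ba, pa, oa, pb, ob, op,
  commV betaK betaVK alphaK alphaVK ba, commV psiK psiVK alphaK alphaVK pa,
  commV omegaK omegaVK alphaK alphaVK oa, commV psiK psiVK betaK betaVK pb,
  commV omegaK omegaVK betaK betaVK ob, commV omegaK omegaVK psiK psiVK op).

Let cancelE := (alphaK, alphaVK, betaK, betaVK, psiK, psiVK, omegaK, omegaVK).

Let mulME := (bha_alphaM hm, bha_betaM hm, ibh_psiM hA, ibh_omegaM hA,
  can_mulM alphaK alphaVK (bha_alphaM hm), can_mulM betaK betaVK (bha_betaM hm),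
  can_mulM psiK psiVK (ibh_psiM hA), can_mulM omegaK omegaVK (ibh_omegaM hA)).

(** BiHom-associativity oriented towards right brackets; [betaV] undoes the twist on the third
    factor. *)
Let mulAE a b c : mu (mu (a ⊗ b) ⊗ c) = mu (alpha a ⊗ mu (b ⊗ betaV c)).
Proof. by rewrite (bha_assoc hm) betaVK. Qed.

Let normE := (mulME, mulAE, cancelE, commE).

Let kappa : {linear A -> A} := alphaV \o alphaV \o beta \o omegaV.

(* [sandwich d (b1 ⊗ b2)] is [a star b] for [d = beta^-1 a]. *)
Let sandwich (d : A) : {linear tensor A A -> A} :=
  mu \o tmap (rmul mu d \o kappa) psiV.

Let sandwichE d u v : sandwich d (u ⊗ v) = mu (mu (kappa u ⊗ d) ⊗ psiV v).
Proof. by rewrite /sandwich /= tmapE. Qed.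

(** Serves for [alpha] and [beta]: with their compatibility with [Delta] it makes the star product
    multiplicative. *)
Lemma sandwich_morph (f : {linear A -> A}) :
  (forall a b, f (mu (a ⊗ b)) = mu (f a ⊗ f b)) ->
  (forall x, f (kappa x) = kappa (f x)) -> (forall x, f (psiV x) = psiV (f x)) ->
  forall d t, f (sandwich d t) = sandwich (f d) (tmap f f t).
Proof.
move=> fM fk fp d; elim/tensor_ind => [|x y IHx IHy|u v].
- by rewrite !linear0.
- by rewrite !linearD IHx IHy.
- by rewrite tmapE !sandwichE !fM fk fp.
Qed.

(* [cubic a b] is the twisted form of [c1 a c2 b c3], read on the common value
   [omega(c1) ⊗ (c21 ⊗ c22) = c11 ⊗ (c12 ⊗ psi(c2))]. *)
Let cubic (a b : A) : {linear tensor A (tensor A A) -> A} :=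
  mu \o tmap (rmul mu (alpha a) \o beta \o kappa \o omegaV)
    (mu \o tmap (alpha \o kappa \o psiV)
           (lmul mu (alpha (betaV b)) \o betaV \o psiV \o psiV)).

Let cubicE a b u v w : cubic a b (u ⊗ (v ⊗ w)) =
  mu (mu (beta (kappa (omegaV u)) ⊗ alpha a)
      ⊗ mu (alpha (kappa (psiV v))
            ⊗ mu (alpha (betaV b) ⊗ betaV (psiV (psiV w))))).
Proof. by rewrite /cubic /= tmapE /= tmapE. Qed.

(** Twisted form of [c1 a b c2], the shape of the terms with coefficient [lambda]. *)
Let weighted (a b : A) : {linear tensor A A -> A} :=
  mu \o tmap (rmul mu (alpha b) \o rmul mu a \o alphaV \o beta \o kappa)
             (beta \o psiV).

Let weightedE a b u v : weighted a b (u ⊗ v) =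
  mu (mu (mu (alphaV (beta (kappa u)) ⊗ a) ⊗ alpha b) ⊗ beta (psiV v)).
Proof. by rewrite /weighted /= tmapE. Qed.

Let kappaD x : Delta (kappa x) = tmap kappa kappa (Delta x).
Proof.
have aVD := can_comulM alphaK alphaVK (ibh_alphaD hA).
have oVD := can_comulM omegaK omegaVK (bhc_omegaD hd).
rewrite /kappa /= -!aVD -(ibh_betaD hA) -oVD.
elim/tensor_ind: (Delta x) => [|y z IHy IHz|u v].
- by rewrite !linear0.
- by rewrite !linearD IHy IHz.
- by rewrite !tmapE.
Qed.

Let psiVD x : Delta (psiV x) = tmap psiV psiV (Delta x).
Proof. by rewrite (can_comulM psiK psiVK (bhc_psiD hd)). Qed.

Let betaVD x : Delta (betaV x) = tmap betaV betaV (Delta x).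
Proof. by rewrite (can_comulM betaK betaVK (ibh_betaD hA)). Qed.

(** * The five terms of [Delta] on a triple product *)

Let expand_right a b u v :
  sandwich (betaV (alpha (beta a)))
    (tmap (lmul mu (omega (mu (kappa u ⊗ betaV (alpha b))))) beta
       (Delta (psiV v)))
  = cubic b a (omega u ⊗ Delta v).
Proof.
(* Once [Delta] is moved past [psiV], both sides are linear in [Delta v], so pure tensors suffice
   and normalization decides. *)
rewrite psiVD; elim/tensor_ind: (Delta v) => [|x y IHx IHy|p q].
- by rewrite linear0r !linear0.
- by rewrite linearDr !linearD IHx IHy.
- by rewrite !tmapE sandwichE cubicE /kappa /= /lmul_fun !normE.
Qed.

(** When [Delta] falls on [b], the result is the nested product [(a * b) * c] that the pre-Lie
    identity subtracts. *)
Let expand_middle a b u v :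
  sandwich (betaV (alpha (beta a)))
    (tmap alpha (rmul mu (psi (psiV v)))
       (tmap (lmul mu (omega (kappa u))) beta (Delta (betaV (alpha b)))))
  = sandwich (betaV (sandwich (betaV (beta a)) (Delta (alpha b))))
      (beta u ⊗ beta v).
Proof.
rewrite betaVD -(ibh_alphaD hA) sandwichE.
elim/tensor_ind: (Delta b) => [|x y IHx IHy|p q].
- by rewrite !linear0 linear0r linear0 linear0l linear0.
- by rewrite !linearD linearDr linearD linearDl linearD IHx IHy.
- by rewrite !tmapE !sandwichE /kappa /= /lmul_fun /rmul_fun !normE.
Qed.

Let expand_left a b u v :
  sandwich (betaV (alpha (beta a)))
    (tmap alpha (rmul mu (psi (psiV v)))
       (tmap alpha (rmul mu (psi (betaV (alpha b)))) (Delta (kappa u))))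
  = cubic a b (tassoc A A A (Delta u ⊗ psi v)).
Proof.
rewrite kappaD; elim/tensor_ind: (Delta u) => [|x y IHx IHy|p q].
- by rewrite !linear0 linear0l !linear0.
- by rewrite !linearD linearDl !linearD IHx IHy.
- by rewrite tassocE !tmapE sandwichE cubicE /kappa /= /rmul_fun !normE.
Qed.

Let expand_weight_inner a b u v :
  sandwich (betaV (alpha (beta a)))
    (tmap alpha (rmul mu (psi (psiV v)))
       (alpha (omega (kappa u)) ⊗ beta (psi (betaV (alpha b)))))
  = weighted a b (u ⊗ v).
Proof. by rewrite tmapE sandwichE weightedE /kappa /= /rmul_fun !normE. Qed.

Let expand_weight_outer a b u v :
  sandwich (betaV (alpha (beta a)))
    (alpha (omega (mu (kappa u ⊗ betaV (alpha b)))) ⊗ beta (psi (psiV v)))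
  = weighted b a (u ⊗ v).
Proof. by rewrite sandwichE weightedE /kappa /= !normE. Qed.

(** Stated for any tensor [t], so that linearity reduces it to pure tensors; it is used at
    [t = Delta c]. *)
Lemma star_star_expand a b t :
  sandwich (betaV (alpha (beta a))) (Delta (sandwich (betaV (alpha b)) t))
  = sandwich (betaV (sandwich (betaV (beta a)) (Delta (alpha b))))
      (tmap beta beta t)
    + (cubic b a (tmap omega Delta t)
       + cubic a b (tassoc A A A (tmap Delta psi t)))
    + lambda *: (weighted a b t + weighted b a t).
Proof.
elim/tensor_ind: t => [|x y IHx IHy|u v].
- by rewrite !linear0 !(addr0, scaler0).
- rewrite !linearD IHx IHy addrACA [X in X + _]addrACA.
  rewrite [X in _ + X + _]addrACA -!scalerDr [X in _ *: X]addrACA.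
  by rewrite scalerDr.
(* The derivation rule is applied to the outer product, then to its left factor. *)
rewrite sandwichE (ibh_deriv hA) (ibh_deriv hA) !linearD !linearZ.
rewrite (expand_right a b u v) (expand_middle a b u v) (expand_left a b u v).
rewrite (expand_weight_inner a b u v) (expand_weight_outer a b u v).
rewrite !tmapE !addrA; congr (_ + _ + _ + _); exact: addrC.
Qed.

Lemma sandwich_preLie a b c :
  let dot x y := sandwich (betaV x) (Delta y) in
  dot (alpha (beta a)) (dot (alpha b) c)
    - dot (dot (beta a) (alpha b)) (beta c)
  = dot (alpha (beta b)) (dot (alpha a) c)
    - dot (dot (beta b) (alpha a)) (beta c).
Proof.
have addrKr (p q r : A) : p + q + r - p = q + r.
  by rewrite addrC -addrA addKr.
move=> dot; rewrite /dot (star_star_expand a b (Delta c)).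
(* Coassociativity gives both cubic terms the same argument. After the nested product cancels,
   exchanging [a] and [b] only swaps summands. *)
rewrite (star_star_expand b a (Delta c)) (bhc_coassoc hd c) -(ibh_betaD hA c).
by rewrite !addrKr; congr (_ + _ *: _); apply: addrC.
Qed.

(** * Multiplicativity of the structure maps for the star product *)

Lemma sandwich_alphaM a b :
  alpha (sandwich (betaV a) (Delta b))
  = sandwich (betaV (alpha a)) (Delta (alpha b)).
Proof.
rewrite sandwich_morph ?(ibh_alphaD hA) ?commE //; first exact: bha_alphaM hm.
  by move=> x; rewrite /kappa /= !(commE, cancelE).
by move=> x; rewrite !commE.
Qed.

Lemma sandwich_betaM a b :
  beta (sandwich (betaV a) (Delta b))
  = sandwich (betaV (beta a)) (Delta (beta b)).
Proof.
rewrite sandwich_morph ?(ibh_betaD hA) ?(betaK, betaVK) //;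
  first exact: bha_betaM hm.
  by move=> x; rewrite /kappa /= !(commE, cancelE).
by move=> x; rewrite !commE.
Qed.

End Star.

Theorem theorem3p26 (K : fieldType) (lambda : K) (A : lmodType K)
    (mu : {linear tensor A A -> A}) (Delta : {linear A -> tensor A A})
    (alpha beta psi omega : {linear A -> A})
    (hA : infBH_bialgebra lambda mu Delta alpha beta psi omega)
    (alpha_bij : bijective alpha) (beta_bij : bijective beta)
    (psi_bij : bijective psi) (omega_bij : bijective omega) :
  bihom_preLie (star mu Delta alpha_bij beta_bij psi_bij omega_bij) alpha beta.
Proof.
have [aK aVK] := (linvK alpha_bij, linvKV alpha_bij).
have [bK bVK] := (linvK beta_bij, linvKV beta_bij).
have [pK pVK] := (linvK psi_bij, linvKV psi_bij).
have [oK oVK] := (linvK omega_bij, linvKV omega_bij).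
split=> [|a b|a b|a b c].
- exact: bha_comm (ibh_assoc hA).
(* [star_tens] at [a], [b] is convertible to [sandwich (betaV a) (Delta b)]. *)
- rewrite !starE; exact: (sandwich_alphaM hA aK aVK bK bVK pK pVK oK oVK).
- rewrite !starE; exact: (sandwich_betaM hA aK aVK bK bVK pK pVK oK oVK).
- rewrite !starE; exact: (sandwich_preLie hA aK aVK bK bVK pK pVK oK oVK).
Qed.
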